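(* Let $\beta=2/\log(e/2)$, let $f=f(n)\to\infty$, let $\epsilon>0$ be a constant, and let $k=k(n)\ge f$ be an integer. Define $\phi=0$ if $k\ge\frac{1+\epsilon}{2}\beta\log n$ and $\phi=n/\exp\!\big(\frac{2(1-\epsilon)}{\beta}k\big)$ if $f\le k<\frac{1+\epsilon}{2}\beta\log n$. Then, as $n\to\infty$, $\Pr(\mathcal G(n,m)\text{ is }k\text{-orientable})\to1$ if $m\le k(n-1)-\phi$, and $\Pr(\mathcal G(n,m)\text{ is }k\text{-orientable})\to0$ if $m\ge kn+1$.
   Context: $\mathcal G(n,m)$ is the uniformly random graph on vertex set $[n]$ with exactly $m$ edges. A graph is $k$-orientable if its edges can be oriented so that every vertex has indegree at most $k$. *)

(* Defs.v *)
From HB Require Import structures.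
From mathcomp Require Import all_boot all_order all_algebra.
From mathcomp Require Import all_classical all_reals all_analysis.
Set Implicit Arguments. Unset Strict Implicit. Unset Printing Implicit Defensive.
Import Order.TTheory GRing.Theory Num.Theory.
Local Open Scope ring_scope.

Definition is_graph (n : nat) (E : {set {set 'I_n}}) : bool :=
  [forall e in E, #|e| == 2%N].

(* k-orientable: there is a choice of head h e \in e for each edge such that
   every vertex v has indegree #{e in E | h e = v} <= k. *)
Definition k_orientable (n k : nat) (E : {set {set 'I_n}}) : bool :=
  [exists h : {ffun {set 'I_n} -> 'I_n},
     [forall e in E, h e \in e] &&
     [forall v : 'I_n, #|[set e in E | h e == v]| <= k]%N].

Definition graphs_nm (n m : nat) : {set {set {set 'I_n}}} :=
  [set E : {set {set 'I_n}} | is_graph E && (#|E| == m)].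

(* Pr(G(n,m) is k-orientable) under the uniform distribution on graphs_nm n m
   (equal to 0 by convention 0/0 = 0 if m > C(n,2)). *)
Definition prob_orientable (R : realType) (n m k : nat) : R :=
  (#|[set E in graphs_nm n m | k_orientable k E]|%:R / #|graphs_nm n m|%:R).

(* Main.v *)
(* By Hakimi's criterion a graph is k-orientable as soon as every vertex set S
   spans at most k|S| edges. For |S| = s = yn and m <= kn, the number of edges of
   G(n,m) inside S is hypergeometric, with moment generating function at most that of
   Bin(m, C(s,2)/C(n,2)); Markov's inequality with z = (1+y)/y gives
     Pr(e(S) > ks) <= ((1+y)^(n-s) y^s)^k.
   The expected number of violating sets of size s is at most C(n,s) times this.
   For small y it is at most (e^(3-k))^s; otherwise, with x = 1-y and t = n-s = xn,
   it is at most (e ((1+y) e^(-y))^k / x)^t. As (1+y) e^(-y) <= exp(-(1 - ln 2) + x/2)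
   and 1 - ln 2 = 2/beta, the base is small even for x near 0 provided that
   n <= t k exp((2/beta - eta) k) for some eta > 0. This is where phi enters: either k
   is so large that n <= exp((2/beta - eta) k), or a violating S forces kt >= phi
   because ks < m <= k(n-1) - phi. *)
Require Import Defs.
From HB Require Import structures.
From mathcomp Require Import all_boot all_order all_algebra.
From mathcomp Require Import all_classical all_reals all_analysis.
From mathcomp Require Import fintype finset zify ring lra.
Set Implicit Arguments. Unset Strict Implicit. Unset Printing Implicit Defensive.
Import Order.TTheory GRing.Theory Num.Theory.
Import numFieldNormedType.Exports.

Local Open Scope nat_scope.

(** * Hakimi's criterion for orientations with prescribed capacities *)

Definition spanned (V : finType) (E : {set {set V}}) (S : {set V}) : nat :=
  #|[set e : {set V} in E | e \subset S]|.

(** An edge inside [S] or [T] lies in [S :|: T], and one inside both lies in [S :&: T]. The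
    inequality is strict because [e0] is counted in [S :|: T] but on neither set alone. *)
Lemma spanned_supermodular (V : finType) (E : {set {set V}}) (e0 : {set V})
    (S T : {set V}) :
  e0 \in E -> e0 \subset S :|: T -> ~~ (e0 \subset S) -> ~~ (e0 \subset T) ->
  spanned (E :\ e0) S + spanned (E :\ e0) T <
  spanned E (S :|: T) + spanned (E :\ e0) (S :&: T).
Proof.
move=> e0E e0ST e0S e0T; rewrite /spanned -cardsUI.
set A := [set e : {set V} in _ | e \subset S]; set B := [set e : {set V} in _ | e \subset T].
have -> : A :&: B = [set e : {set V} in E :\ e0 | e \subset S :&: T].
  by apply/setP => e; rewrite !inE subsetI; case: (e == e0); case: (e \in E).
rewrite ltn_add2r; apply/proper_card/properP; split.
  apply/subsetP => e; rewrite !inE -andb_orr => /andP[/andP[_ ->]] /=.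
  by case/orP => /subset_trans; apply; rewrite ?subsetUl ?subsetUr.
by exists e0; rewrite !inE ?e0E ?e0ST // eqxx.
Qed.

Lemma spanned_setD1 (V : finType) (E : {set {set V}}) (e0 : {set V}) (S : {set V}) :
  e0 \in E -> spanned E S = (e0 \subset S) + spanned (E :\ e0) S.
Proof.
move=> e0E; rewrite /spanned (cardsD1 e0) inE e0E /=; congr (_ + #|pred_of_set _|).
by apply/setP => e; rewrite !inE; case: (e == e0).
Qed.

(* Orient one edge [a b] at a time. If neither end can absorb it, there are tight
   sets [S] around [a] and [T] around [b], and supermodularity makes [S :|: T]
   span too many edges. *)
Lemma orientable_capacities (V : finType) (v0 : V) (E : {set {set V}}) (c : V -> nat) :
  {in E, forall e : {set V}, #|e| = 2} ->
  (forall S : {set V}, spanned E S <= \sum_(v in S) c v) ->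
  exists h : {ffun {set V} -> V}, {in E, forall e : {set V}, h e \in e} /\
    forall v, #|[set e : {set V} in E | h e == v]| <= c v.
Proof.
have [N] := ubnP #|E|; elim: N => // N IHN in E c *.
rewrite ltnS => leEN E2 Ec.
have [->|[e0 e0E]] := set_0Vmem E.
  exists [ffun=> v0]; split=> [e|v]; first by rewrite inE.
  by rewrite (_ : [set _ in _ | _] = set0) ?cards0 //; apply/setP => e; rewrite !inE.
have ltD : #|E :\ e0| < N by move: leEN; rewrite (cardsD1 e0 E) e0E.
have D2 : {in E :\ e0, forall e : {set V}, #|e| = 2}.
  by move=> e /setD1P[_]; apply: E2.
have assign x : x \in e0 ->
  (forall S : {set V}, x \in S -> ~~ (e0 \subset S) ->
     spanned (E :\ e0) S < \sum_(v in S) c v) ->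
  exists h : {ffun {set V} -> V}, {in E, forall e : {set V}, h e \in e} /\
    forall v, #|[set e : {set V} in E | h e == v]| <= c v.
  move=> xe0 slack.
  (* Heading [e0] at [x] costs one unit of [c x]. Sets containing [e0] lose that edge in exchange;
     the other sets containing [x] can afford the loss by [slack]. *)
  pose c' v := c v - (v == x).
  (* The slack of the singleton of [x], which cannot contain a two-element edge, ensures that the
     truncated subtraction in [c'] is a true one. *)
  have cx : 0 < c x.
    have := slack [set x]; rewrite set11 big_set1 => /(_ isT) H.
    apply: leq_ltn_trans (H _) => //.
    by apply/negP => /subset_leq_card; rewrite cards1 (E2 _ e0E).
  have c'E (S : {set V}) : \sum_(v in S) c v = (x \in S) + \sum_(v in S) c' v.
    have [xS|xS] := boolP (x \in S).
      rewrite (bigD1 x) // [X in _ = _ + X](bigD1 x) //= /c' eqxx addnA subnKC //.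
      by congr addn; apply: eq_bigr => v /andP[_ /negPf->]; rewrite subn0.
    apply: eq_bigr => v vS; rewrite /c' (_ : (v == x) = false) ?subn0 //.
    by apply: contraNF xS => /eqP<-.
  have [|h [hE hc]] := IHN (E :\ e0) c' ltD D2.
    move=> S; have := Ec S; rewrite c'E (spanned_setD1 _ e0E).
    have [xS|xS] := boolP (x \in S); last first.
      by rewrite add0n; apply: leq_trans; exact: leq_addl.
    have [e0S|e0S] := boolP (e0 \subset S); first by rewrite leq_add2l.
    by have := slack S xS e0S; rewrite c'E xS /=; lia.
  exists [ffun e => if e == e0 then x else h e]; split=> [e eE|v].
    by rewrite ffunE; case: eqVneq => [->//|ne]; apply: hE; rewrite !inE ne.
  rewrite (cardsD1 e0) !inE ffunE e0E eqxx /= [x == v]eq_sym.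
  have -> : [set e : {set V} in E | [ffun e => if e == e0 then x else h e] e == v] :\ e0 =
            [set e : {set V} in E :\ e0 | h e == v].
    by apply/setP => e; rewrite !inE ffunE; case: (e == e0).
  have := hc v; rewrite /c'; case: eqVneq => [->|_]; last by rewrite subn0.
  by rewrite subn1 -[X in _ -> (_ <= X)](prednK cx).
have /cards2P[a [b [ab e0ab]]] : #|e0| == 2 by rewrite (E2 _ e0E).
have tight x :
  (forall S : {set V}, x \in S -> ~~ (e0 \subset S) ->
     spanned (E :\ e0) S < \sum_(v in S) c v) \/
  exists S : {set V}, [/\ x \in S, ~~ (e0 \subset S) &
     \sum_(v in S) c v <= spanned (E :\ e0) S].
  have [/existsP[S /and3P[xS e0S tS]]|/existsPn noS] := boolP [exists S : {set V},
     [&& x \in S, ~~ (e0 \subset S) & \sum_(v in S) c v <= spanned (E :\ e0) S]].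
    by right; exists S.
  by left=> S xS e0S; have := noS S; rewrite xS e0S /= -ltnNge.
have [|[S [aS e0S tS]]] := tight a.
  by apply: assign; rewrite e0ab !inE eqxx.
have [|[T [bT e0T tT]]] := tight b.
  by apply: assign; rewrite e0ab !inE eqxx orbT.
exfalso.
have e0ST : e0 \subset S :|: T.
  by rewrite e0ab subUset !sub1set !inE aS bT orbT.
have := spanned_supermodular e0E e0ST e0S e0T.
have modular : \sum_(v in S :|: T) c v + \sum_(v in S :&: T) c v =
               \sum_(v in S) c v + \sum_(v in T) c v.
  rewrite !(big_mkcond (fun v => v \in _)) -!big_split; apply: eq_bigr => v _.
  by rewrite !inE; case: (v \in S); case: (v \in T); rewrite /= ?addn0.
have := Ec (S :|: T); have := Ec (S :&: T); rewrite (spanned_setD1 (S :&: T) e0E).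
move=> capST cupST; apply/negP; rewrite -leqNgt.
apply: leq_trans (leq_add tS tT); rewrite -modular; apply: leq_add => //.
by apply: leq_trans capST; exact: leq_addl.
Qed.

Local Open Scope ring_scope.

(** * Moment generating function of the hypergeometric law *)

Lemma card_supersets (T : finType) (U F : {set T}) (m : nat) :
  F \subset U -> (#|F| <= m)%N ->
  #|[set E : {set T} | [&& E \subset U, #|E| == m & F \subset E]]| =
    'C(#|U| - #|F|, m - #|F|).
Proof.
move=> FU Fm; have <- : #|U :\: F| = (#|U| - #|F|)%N by rewrite cardsD (setIidPr FU).
rewrite -cards_draws -[RHS](@card_in_imset _ _ (fun E => E :|: F)).
  congr #|pred_of_set _|; apply/setP => E; rewrite !inE.
  apply/and3P/imsetP => [[EU /eqP Em FE]|[D]].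
    exists (E :\: F); last by rewrite setDE setUIl (setUC (~: F)) setUCr setIT; apply/esym/setUidPl.
    by rewrite inE setSD //= cardsD (setIidPr FE) Em.
  rewrite inE subsetD => /andP[/andP[DU DF] /eqP Dm] ->; split.
  - by rewrite subUset DU.
  - by rewrite cardsU disjoint_setI0 // cards0 subn0 Dm subnK.
  - exact: subsetUr.
move=> D D'; rewrite !inE !subsetD => /andP[/andP[_ DF] _] /andP[/andP[_ D'F] _] eqD.
have: (D :|: F) :\: F = (D' :|: F) :\: F by rewrite eqD.
by rewrite !setDUl !setDv !setU0; move/setDidPl: DF => ->; move/setDidPl: D'F => ->.
Qed.

(** Double counting of the pairs [(E, F)] with [F] an [i]-subset of [E :&: A]; these are the
    binomial moments of [#|E :&: A|]. *)
Lemma sum_bin_cap (T : finType) (U A : {set T}) (m i : nat) :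
  A \subset U -> (i <= m)%N ->
  (\sum_(E : {set T} | (E \subset U) && (#|E| == m)) 'C(#|E :&: A|, i) =
    'C(#|A|, i) * 'C(#|U| - i, m - i))%N.
Proof.
move=> AU im.
under eq_bigr => E _ do rewrite -cards_draws -sum1_card.
rewrite (exchange_big_dep (fun F : {set T} => (F \subset A) && (#|F| == i))) /=; last first.
  by move=> E F _; rewrite inE subsetI -andbA => /and3P[_ -> ->].
rewrite -cards_draws -sum1_card big_distrl /=.
rewrite [RHS](eq_bigl (fun F : {set T} => (F \subset A) && (#|F| == i))); last first.
  by move=> F; rewrite inE.
apply: eq_bigr => F /andP[FA /eqP Fi]; rewrite mul1n -Fi.
rewrite -card_supersets ?Fi ?(subset_trans FA) //.
rewrite -sum1_card; apply: eq_bigl => E.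
by rewrite !inE subsetI FA Fi eqxx !andbT -andbA.
Qed.

(** Factor by factor, [(a - j) / (N - j) <= a / N] when [a <= N]. *)
Lemma ler_bin_ratio (R : numFieldType) (a N i : nat) :
  (a <= N)%N -> 'C(a, i)%:R * N%:R ^+ i <= 'C(N, i)%:R * a%:R ^+ i :> R.
Proof.
move=> aN; rewrite -!natrX -!natrM ler_nat.
have [ia|ai] := leqP i a; last by rewrite bin_small.
rewrite -(leq_pmul2r (fact_gt0 i)) ![(_ * _ * i`!)%N]mulnAC !bin_ffact.
elim: i ia => // i IHi ia.
rewrite !ffactnSr !expnSr !mulnA -![(_ * _ * _ ^ i)%N]mulnAC -!mulnA !mulnA.
rewrite -mulnA -[X in (_ <= X)%N]mulnA; apply: leq_mul; first exact/IHi/ltnW.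
by nia.
Qed.

(* The generating function of the hypergeometric law of [#|E :&: A|] is dominated
   coefficientwise, in powers of [w], by that of the binomial law. *)
Lemma hypergeometric_mgf (R : numFieldType) (T : finType) (U A : {set T}) (m : nat) (w : R) :
  A \subset U -> (m <= #|U|)%N -> 0 <= w ->
  \sum_(E : {set T} | (E \subset U) && (#|E| == m)) (1 + w) ^+ #|E :&: A| <=
  'C(#|U|, m)%:R * (1 + #|A|%:R / #|U|%:R * w) ^+ m.
Proof.
move=> AU mU w0; have aN := subset_leq_card AU.
under eq_bigr => E /andP[_ /eqP Em].
  have Am : (#|E :&: A| <= m)%N by rewrite -Em subset_leq_card // subsetIl.
  rewrite addrC exprD1n.
  (* All expansions are extended to [i <= m], with vanishing new coefficients, so that the sums over
     [i] and [E] can be exchanged. *)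
  rewrite (big_ord_widen_cond m.+1 (fun=> true) (fun i => w ^+ i *+ 'C(#|E :&: A|, i))) //=.
  rewrite big_mkcond /=.
  under eq_bigr => i _.
    rewrite (_ : (if _ then _ else _) = w ^+ i *+ 'C(#|E :&: A|, i)); last first.
      by case: ifP => // /negbT; rewrite -leqNgt => /bin_small ->.
  over.
over.
rewrite exchange_big /= addrC exprD1n mulr_sumr; apply: ler_sum => i _.
have im : (i <= m)%N by rewrite -ltnS.
under eq_bigr => E _ do rewrite -mulr_natr.
rewrite -mulr_sumr -natr_sum sum_bin_cap // exprMn -[_ *+ 'C(m, i)]mulr_natr.
rewrite [leRHS](_ : _ = w ^+ i * ((#|A|%:R / #|U|%:R) ^+ i * ('C(#|U|, m)%:R * 'C(m, i)%:R))); last by ring.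
apply: ler_wpM2l; first exact: exprn_ge0.
(* This identity is the case [A = U] of [sum_bin_cap]. *)
have -> : 'C(#|U|, m)%:R * 'C(m, i)%:R = ('C(#|U|, i)%:R * 'C(#|U| - i, m - i)%:R : R).
  rewrite -!natrM -(sum_bin_cap (subxx U) im) -cards_draws -sum1_card big_distrl /=.
  congr _%:R; apply: eq_big => [E|E]; rewrite inE // => /andP[EU /eqP Em].
  by rewrite (setIidPl EU) Em mul1n.
rewrite natrM mulrA; apply: ler_wpM2r; first exact: ler0n.
have [U0|U0] := posnP #|U|.
  have i0 : i = 0%N :> nat by lia.
  by rewrite i0 !expr0 !bin0 mul1r.
rewrite expr_div_n mulrAC ler_pdivlMr ?exprn_gt0 ?ltr0n //.
by rewrite [leRHS]mulrC; exact: ler_bin_ratio.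
Qed.

(** * Overfull sets and the union bound *)

Lemma k_orientable_spanned (n k : nat) (E : {set {set 'I_n}}) :
  (0 < n)%N -> is_graph E -> (forall S, (spanned E S <= k * #|S|)%N) ->
  k_orientable k E.
Proof.
case: n E => // n E _ /forall_inP E2 Ek.
have [e eE|S|h [hE hk]] := @orientable_capacities _ (ord0 : 'I_n.+1) E (fun=> k).
- exact/eqP/E2.
- by rewrite sum_nat_const mulnC.
apply/existsP; exists h; apply/andP; split; first exact/forall_inP.
exact/forallP.
Qed.

Lemma k_orientable_card (n k : nat) (E : {set {set 'I_n}}) :
  k_orientable k E -> (#|E| <= k * n)%N.
Proof.
case/existsP => h /andP[_ /forallP hk].
rewrite -sum1_card (partition_big h predT) //= -[X in (_ <= k * X)%N]card_ord mulnC.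
rewrite -sum_nat_const; apply: leq_sum => v _.
apply: leq_trans (hk v); rewrite -sum1_card.
by apply/eq_leq/eq_bigl => e; rewrite inE.
Qed.

Lemma graphs_nmE (n m : nat) :
  graphs_nm n m = [set E : {set {set 'I_n}} |
    (E \subset [set e : {set 'I_n} | e \subset [set: 'I_n] & #|e| == 2]) && (#|E| == m)].
Proof.
apply/setP => E; rewrite !inE; congr (_ && _).
apply/forall_inP/subsetP => E2 e eE; first by rewrite inE subsetT E2.
by have := E2 _ eE; rewrite inE => /andP[].
Qed.

Lemma card_graphs_nm (n m : nat) : #|graphs_nm n m| = 'C('C(n, 2), m).
Proof. by rewrite graphs_nmE cards_draws cards_draws cardsT card_ord. Qed.

(* Markov's inequality for [z ^ e(S)] with [z = 1 + n/s], the optimal choice in the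
   limit of large [n]. *)
Lemma card_overfull (R : numFieldType) (n m k : nat) (S : {set 'I_n}) :
  (1 < n)%N -> (m <= 'C(n, 2))%N -> (m <= k * n)%N -> (0 < #|S|)%N ->
  #|[set E in graphs_nm n m | (k * #|S| < spanned E S)%N]|%:R <=
  #|graphs_nm n m|%:R * ((1 + #|S|%:R / n%:R) ^+ (n - #|S|) * (#|S|%:R / n%:R) ^+ #|S|) ^+ k :> R.
Proof.
move=> n1 mC mk; set s := #|S| => S0; set y : R := s%:R / n%:R.
have sn : (s <= n)%N by rewrite -[X in (_ <= X)%N](card_ord n) max_card.
have n0 : 0 < n%:R :> R by rewrite ltr0n; lia.
have s0 : 0 < s%:R :> R by rewrite ltr0n.
have y0 : 0 < y by rewrite divr_gt0.
have y1 : y <= 1 by rewrite ler_pdivrMr // mul1r ler_nat.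
have z0 : 0 < 1 + y^-1 by rewrite addr_gt0 // invr_gt0.
pose U := [set e : {set 'I_n} | e \subset [set: 'I_n] & #|e| == 2%N].
pose A := [set e : {set 'I_n} | e \subset S & #|e| == 2%N].
have cU : #|U| = 'C(n, 2) by rewrite cards_draws cardsT card_ord.
have cA : #|A| = 'C(s, 2) by rewrite cards_draws.
have AU : A \subset U.
  by apply/subsetP => e; rewrite !inE subsetT => /andP[].
have spannedA E : E \in graphs_nm n m -> spanned E S = #|E :&: A|.
  rewrite graphs_nmE inE => /andP[/subsetP EU _].
  apply: eq_card => e; rewrite !inE; case eE: (e \in E) => //=.
  by have := EU e eE; rewrite inE => /andP[_ ->]; rewrite andbT.
have markov : #|[set E in graphs_nm n m | (k * s < spanned E S)%N]|%:R *
    (1 + y^-1) ^+ (k * s) <= #|graphs_nm n m|%:R * (1 + y) ^+ m.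
  have /le_trans : #|[set E in graphs_nm n m | (k * s < spanned E S)%N]|%:R *
    (1 + y^-1) ^+ (k * s) <= \sum_(E in graphs_nm n m) (1 + y^-1) ^+ #|E :&: A|.
    rewrite -sum1_card natr_sum mulr_suml.
    rewrite (eq_bigl (fun E => (E \in graphs_nm n m) && (k * s < spanned E S)%N)); last first.
      by move=> E; rewrite inE.
    rewrite big_mkcondr; apply: ler_sum => E EG.
    case: ifP => [|_]; last by rewrite exprn_ge0 // ltW.
    rewrite spannedA // => /ltnW lt; rewrite mul1r; apply: ler_weXn2l => //.
    by rewrite lerDl invr_ge0 ltW.
  apply; rewrite card_graphs_nm -cU graphs_nmE.
  rewrite (eq_bigl (fun E : {set {set 'I_n}} => (E \subset U) && (#|E| == m))); last first.
    by move=> E; rewrite inE.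
  apply: le_trans (@hypergeometric_mgf R _ U A m y^-1 AU _ _) _.
  - by rewrite cU.
  - by rewrite invr_ge0 ltW.
  apply: ler_wpM2l; first exact: ler0n.
  have C0 : 0 < 'C(n, 2)%:R :> R by rewrite ltr0n bin_gt0.
  apply: lerXn2r; rewrite ?nnegrE ?addr_ge0 ?mulr_ge0 ?invr_ge0 ?ler0n ?(ltW y0) //.
  (* Since [C(s,2) / C(n,2) <= y^2], the weight [w = 1/y] contributes at most [y] per edge. *)
  rewrite lerD2l cA cU ler_pdivrMr // ler_pdivrMr // /y.
  rewrite -mulrA [leRHS](_ : _ = (s%:R * s%:R) * ('C(n, 2)%:R) / (n%:R * n%:R)); last first.
    by field; rewrite gt_eqF.
  rewrite ler_pdivlMr ?mulr_gt0 // -!natrM ler_nat.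
  have h j : (2 * 'C(j, 2) = j * j.-1)%N by rewrite -[LHS]mul_bin_diag bin1.
  rewrite -(leq_pmul2l (isT : 0 < 2)%N) mulnA h [leqRHS]mulnCA h.
  have -> : (s * s.-1 * (n * n) = (s * n) * (s.-1 * n))%N by ring.
  have -> : (s * s * (n * n.-1) = (s * n) * (s * n.-1))%N by ring.
  by rewrite leq_mul2l; apply/orP; right; rewrite -!subn1; nia.
(* As [1 + 1/y = (1 + y)/y], the claimed bound is the [k]-th power of a quotient, to be matched with
   [markov] through [m <= k * n]. *)
have -> : (1 + y) ^+ (n - s) * y ^+ s = (1 + y) ^+ n / (1 + y^-1) ^+ s.
  clearbody y; have -> : 1 + y^-1 = (1 + y) / y by field; rewrite gt_eqF.
  rewrite expr_div_n invf_div expfB_cond; first by rewrite mulrA mulrAC.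
  by rewrite gt_eqF // addr_gt0.
have zk : 0 < (1 + y^-1) ^+ (k * s) by rewrite exprn_gt0.
rewrite expr_div_n -!exprM mulrA [(s * k)%N]mulnC ler_pdivlMr //.
apply: le_trans markov _; apply: ler_wpM2l; first exact: ler0n.
by apply: ler_weXn2l; rewrite ?lerDl 1?ltW // mulnC.
Qed.

(** Bound on the expected number of violating sets of size [s]: the number of such sets times the
    probability bound of [card_overfull]. *)
Definition union_term (R : realType) (n k s : nat) : R :=
  'C(n, s)%:R * ((1 + s%:R / n%:R) ^+ (n - s) * (s%:R / n%:R) ^+ s) ^+ k.

(** A violating [S] satisfies [k * #|S| < spanned E S <= m] and is nonempty, as the empty set spans
    no edge; hence the range of [s]. *)
Lemma prob_orientable_ge (R : realType) (n m k : nat) :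
  (1 < n)%N -> (m <= 'C(n, 2))%N -> (m <= k * n)%N ->
  1 - \sum_(s < n.+1 | (0 < s)%N && (k * s < m)%N) union_term R n k s
  <= prob_orientable R n m k.
Proof.
move=> n1 mC mk; rewrite /prob_orientable /union_term.
pose F (s : nat) : R := ((1 + s%:R / n%:R) ^+ (n - s) * (s%:R / n%:R) ^+ s) ^+ k.
have G0 : 0 < #|graphs_nm n m|%:R :> R by rewrite ltr0n card_graphs_nm bin_gt0.
have -> : \sum_(s < n.+1 | (0 < s)%N && (k * s < m)%N) 'C(n, s)%:R * F s =
    \sum_(S : {set 'I_n} | (0 < #|S|)%N && (k * #|S| < m)%N) F #|S|.
  have cS (S : {set 'I_n}) : (#|S| < n.+1)%N.
    by rewrite ltnS -[X in (_ <= X)%N](card_ord n) max_card.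
  rewrite [RHS](partition_big (fun S => Ordinal (cS S))
    (fun s : 'I_n.+1 => (0 < s)%N && (k * s < m)%N)) //=.
  apply: eq_bigr => s Ps.
  rewrite (eq_bigl (fun S => S \in [set S : {set 'I_n} | #|S| == s])); last first.
    move=> S; rewrite inE -val_eqE /=.
    by case: eqP => [->|_]; rewrite ?Ps // andbF.
  rewrite (eq_bigr (fun=> F s)) => [|S]; last by rewrite inE => /eqP->.
  by rewrite sumr_const card_draws card_ord mulr_natl.
set good := [set E in graphs_nm n m | k_orientable k E].
have cardG : #|graphs_nm n m|%:R = #|good|%:R + #|graphs_nm n m :\: good|%:R :> R.
  by rewrite -natrD -(cardsID good) (setIidPr _) //; apply/subsetP => E; rewrite inE => /andP[].
rewrite ler_pdivlMr // mulrBl mul1r lerBlDr {1}cardG lerD2l mulr_suml.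
apply: le_trans (_ : \sum_(S : {set 'I_n} | (0 < #|S|)%N && (k * #|S| < m)%N)
  #|[set E in graphs_nm n m | (k * #|S| < spanned E S)%N]|%:R <= _); last first.
  apply: ler_sum => S /andP[S0 _]; rewrite mulrC.
  exact: card_overfull.
rewrite -natr_sum ler_nat.
under [X in (_ <= X)%N]eq_bigr => S _.
  rewrite -sum1_card (eq_bigl (fun E => (E \in graphs_nm n m) &&
    (k * #|S| < spanned E S)%N)); last by move=> E; rewrite inE.
  rewrite big_mkcondr /=; over.
(* After the exchange it suffices that every non-orientable graph is counted for at least one set
   [S]. *)
rewrite exchange_big -sum1_card /= [leqRHS](big_setID good) /=.
apply: leq_trans (leq_addl _ _); apply: leq_sum => E /setDP[EG Egood].
have Em : #|E| = m by move: EG; rewrite inE => /andP[_ /eqP].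
have graphE : is_graph E by move: EG; rewrite inE => /andP[].
have [S ES] : exists S : {set 'I_n}, (k * #|S| < spanned E S)%N.
  apply/existsP; apply: contraNT Egood => /existsPn noS.
  rewrite inE EG k_orientable_spanned // ?(ltnW n1) // => S.
  by rewrite leqNgt noS.
have spm : (spanned E S <= m)%N.
  by rewrite -Em; apply/subset_leq_card/subsetP => e; rewrite inE => /andP[].
rewrite (bigD1 S) ?ES //= (leq_ltn_trans _ (leq_trans ES spm)) // andbT card_gt0.
apply: contraTneq ES => ->; rewrite -leqNgt cards0 muln0 leqn0 cards_eq0.
apply/eqP/setP => e; rewrite !inE subset0; apply/negbTE/negP => /andP[eE /eqP e0].
by move/forall_inP: graphE => /(_ e eE); rewrite e0 cards0.
Qed.

(** * Estimates of the union bound terms *)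

(** The left side is one term in the expansion of [(y + (1 - y))^n = 1]. *)
Lemma bin_ratio_le1 (R : realFieldType) (n s : nat) (y : R) :
  0 <= y <= 1 -> (s <= n)%N -> 'C(n, s)%:R * (y ^+ s * (1 - y) ^+ (n - s)) <= 1.
Proof.
move=> /andP[y0 y1] sn; have x0 : 0 <= 1 - y by rewrite subr_ge0.
rewrite -[leRHS](expr1n _ n) -[X in _ <= X ^+ n](subrK y) [leRHS]exprDn.
rewrite (bigD1 (Ordinal (sn : (s < n.+1)%N))) //= mulr_natl [y ^+ s * _]mulrC lerDl.
by apply: sumr_ge0 => i _; rewrite mulrn_wge0 // mulr_ge0 // exprn_ge0.
Qed.

Section UnionTerm.
Variables (R : realType) (n k s : nat).
Hypotheses (k0 : (0 < k)%N) (s0 : (0 < s)%N) (sn : (s < n)%N).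
Let y : R := s%:R / n%:R.
Let x : R := (n - s)%:R / n%:R.

Let n0 : 0 < n%:R :> R. Proof. by rewrite ltr0n (leq_ltn_trans (leq0n s) sn). Qed.
Let y0 : 0 < y. Proof. by rewrite divr_gt0 // ltr0n. Qed.
Let x0 : 0 < x. Proof. by rewrite divr_gt0 // ltr0n subn_gt0. Qed.
Let xE : x = 1 - y.
Proof. by rewrite /x /y natrB 1?ltnW // mulrBl divff // gt_eqF. Qed.

(** One of the [k] factors [y ^+ s], together with [x ^+ (n - s)], absorbs the binomial coefficient;
    this leaves the exponent [k.-1] and the division by [x ^+ (n - s)]. *)
Let union_term_le :
  union_term R n k s <= (1 + y) ^+ ((n - s) * k) * y ^+ (s * k.-1) / x ^+ (n - s).
Proof.
have ys : 0 < y ^+ s by rewrite exprn_gt0.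
rewrite ler_pdivlMr ?exprn_gt0 // /union_term -/y exprMn -!exprM.
have -> : (s * k = s + s * k.-1)%N by rewrite -mulnS prednK.
rewrite exprD; have := @bin_ratio_le1 R n s y.
rewrite -xE ltW //= -subr_ge0 -xE ltW // => /(_ isT (ltnW sn)) bin1.
rewrite [leLHS](_ : _ = 'C(n, s)%:R * (y ^+ s * x ^+ (n - s)) *
  ((1 + y) ^+ ((n - s) * k) * y ^+ (s * k.-1))); last by ring.
by apply: ler_piMl => //; rewrite mulr_ge0 // exprn_ge0 // ?addr_ge0 // ltW.
Qed.

(** The three factors are at most [exp(sk)], [exp(-2s(k-1))] and [exp(s)], with product
    [exp(s(3-k))]. *)
Lemma union_term_small : y <= expR (-2) ->
  union_term R n k s <= (expR 3 * expR (-1) ^+ k) ^+ s.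
Proof.
move=> ye; apply: le_trans union_term_le _.
have t0 : 0 < (n - s)%:R :> R by rewrite ltr0n subn_gt0.
have b1 : (1 + y) ^+ ((n - s) * k) <= expR (s%:R * k%:R).
  apply: (@le_trans _ _ (expR y ^+ ((n - s) * k))).
    by rewrite lerXn2r ?nnegrE ?expR_ge0 ?expR_ge1Dx // addr_ge0 // ltW.
  rewrite -expRM_natl ler_expR natrM -mulrA [k%:R * _]mulrC mulrA.
  rewrite ler_wpM2r // /y mulrCA ler_piMr // ler_pdivrMr // mul1r ler_nat.
  exact: leq_subr.
have b2 : y ^+ (s * k.-1) <= expR (- (2 * (s%:R * (k%:R - 1)))).
  apply: (@le_trans _ _ (expR (-2) ^+ (s * k.-1))).
    by rewrite lerXn2r ?nnegrE ?expR_ge0 // ltW.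
  rewrite -expRM_natl ler_expR natrM -subn1 natrB //; lra.
(* Here [1/x = 1 + s/(n-s) <= exp(s/(n-s))]. *)
have b3 : (x ^+ (n - s))^-1 <= expR s%:R.
  rewrite -exprVn [s%:R](_ : _ = (n - s)%:R * (s%:R / (n - s)%:R)); last first.
    by rewrite mulrCA divff ?mulr1 // gt_eqF.
  rewrite expRM_natl lerXn2r ?nnegrE ?expR_ge0 ?invr_ge0 ?(ltW x0) //.
  apply: le_trans (expR_ge1Dx _); rewrite /x invf_div.
  by rewrite -[X in X%:R / _ <= _](subnK (ltnW sn)) natrD mulrDl divff // gt_eqF.
rewrite (_ : (_ * _) ^+ s =
    expR (s%:R * k%:R) * expR (- (2 * (s%:R * (k%:R - 1)))) * expR s%:R).
  have Y0 : 0 <= y ^+ (s * k.-1) by rewrite exprn_ge0 // ltW.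
  have X0 : 0 <= (1 + y) ^+ ((n - s) * k) by rewrite exprn_ge0 // addr_ge0 // ltW.
  apply: ler_pM => //; first exact: mulr_ge0.
    by rewrite invr_ge0 exprn_ge0 // ltW.
  exact: ler_pM.
by rewrite -expRM_natl -expRD -expRM_natl -!expRD; congr expR; ring.
Qed.

(* [y = 1 - x <= exp(-x)] and [x * s = y * (n - s)] turn [y ^+ s] into an
   [n - s]-th power. *)
Lemma union_term_large :
  union_term R n k s <= (expR 1 * ((1 + y) * expR (- y)) ^+ k / x) ^+ (n - s).
Proof.
apply: le_trans union_term_le _.
rewrite [leRHS]exprMn exprVn; apply: ler_wpM2r.
  by rewrite invr_ge0 exprn_ge0 // ltW.
have b : y ^+ (s * k.-1) <= expR (- y * (k%:R - 1)) ^+ (n - s).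
  apply: (@le_trans _ _ (expR (- x) ^+ (s * k.-1))).
    rewrite lerXn2r ?nnegrE ?expR_ge0 ?(ltW y0) //.
    by apply: le_trans (expR_ge1Dx _); rewrite xE opprB addrC subrK.
  rewrite -!expRM_natl ler_expR natrM -subn1 natrB // /x /y.
  by rewrite le_eqVlt; apply/orP; left; apply/eqP; ring.
apply: (@le_trans _ _ ((1 + y) ^+ ((n - s) * k) * expR (- y * (k%:R - 1)) ^+ (n - s))).
  by rewrite ler_wpM2l // exprn_ge0 // addr_ge0 // ltW.
rewrite mulnC exprM -exprMn lerXn2r ?nnegrE //.
- by rewrite mulr_ge0 ?expR_ge0 // exprn_ge0 // addr_ge0 // ltW.
- by rewrite mulr_ge0 ?expR_ge0 // exprn_ge0 // mulr_ge0 ?expR_ge0 // addr_ge0 // ltW.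
(* The factor [expR 1] pays for replacing [k - 1] by [k] in the exponent, since [y <= 1]. *)
rewrite exprMn mulrCA ler_wpM2l ?exprn_ge0 ?addr_ge0 ?(ltW y0) //.
rewrite -expRM_natl -expRD ler_expR.
have y1 : y <= 1 by rewrite -subr_ge0 -xE ltW.
by rewrite mulrBr; lra.
Qed.

End UnionTerm.

(* One summand for each range of [y = s/n]: [y <= exp(-2)], then [1 - y >= eta],
   then [1 - y <= eta]; the last one uses [k <= 4/eta * exp(eta k/4)]. *)
Definition rate (R : realType) (eta : R) (k : nat) : R :=
  geometric (expR 3) (expR (-1)) k +
  geometric (expR 1 / eta) ((1 + expR (-2)) * expR (- expR (-2))) k +
  geometric (4 * expR 1 / eta) (expR (- (eta / 4))) k.

Lemma rate_ge0 (R : realType) (eta : R) (k : nat) : 0 < eta -> 0 <= rate eta k.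
Proof.
move=> e0; rewrite /rate /geometric /=.
by rewrite !addr_ge0 // mulr_ge0 ?exprn_ge0 ?divr_ge0 ?mulr_ge0 ?addr_ge0 ?expR_ge0 // ltW.
Qed.

(** All three ratios lie in [[0, 1)]; the middle one because [1 + d < exp(d)] for [d = exp(-2)]. *)
Lemma rate_cvg0 (R : realType) (eta : R) : 0 < eta -> (rate eta @ \oo --> (0 : R))%classic.
Proof.
move=> e0; rewrite -[0 : R](addr0 0) -[X in X + _](addr0 0) /rate.
apply: cvgD; first apply: cvgD; apply: cvg_geometric; rewrite ger0_norm ?mulr_ge0 ?addr_ge0 ?expR_ge0 //.
- by rewrite expRN ltr_pdivrMr ?expR_gt0 // mul1r expR_gt1Dx // gt_eqF // expR_gt0.
- by rewrite expR_lt1; lra.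
Qed.

Lemma union_term_rate (R : realType) (n k s : nat) (eta : R) :
  (0 < k)%N -> (0 < s)%N -> (s < n)%N -> 0 < eta ->
  n%:R <= (n - s)%:R * k%:R * expR ((1 - ln 2 - eta) * k%:R) ->
  union_term R n k s <= rate eta k ^+ s + rate eta k ^+ (n - s).
Proof.
move=> k0 s0 sn e0 hn; have Q0 := rate_ge0 k e0.
have n0 : 0 < n%:R :> R by rewrite ltr0n (leq_ltn_trans (leq0n s) sn).
have t0 : 0 < (n - s)%:R :> R by rewrite ltr0n subn_gt0.
set y : R := s%:R / n%:R; set x : R := (n - s)%:R / n%:R.
have y0 : 0 < y by rewrite divr_gt0 // ltr0n.
have x0 : 0 < x by rewrite divr_gt0.
have xE : x = 1 - y.
  by rewrite /x /y natrB 1?ltnW // mulrBl divff // gt_eqF.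
have [g1 g2 g3] : [/\ 0 <= geometric (expR 3 : R) (expR (-1)) k,
    0 <= geometric (expR 1 / eta) ((1 + expR (-2)) * expR (- expR (-2))) k &
    0 <= geometric (4 * expR 1 / eta) (expR (- (eta / 4))) k].
  by rewrite /geometric /=; split;
    rewrite mulr_ge0 ?exprn_ge0 ?divr_ge0 ?mulr_ge0 ?addr_ge0 ?expR_ge0 // ltW.
have [ye|ye] := leP y (expR (-2)).
  apply: le_trans (union_term_small k0 s0 sn ye) _.
  rewrite -[leLHS]addr0 lerD ?exprn_ge0 // lerXn2r ?nnegrE //.
  by rewrite /rate -addrA lerDl addr_ge0.
apply: le_trans (union_term_large R k0 s0 sn) _; rewrite -/y -/x.
rewrite -[leLHS]add0r lerD ?exprn_ge0 //.
have base0 : 0 <= (1 + y) * expR (- y).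
  by rewrite mulr_ge0 ?expR_ge0 // addr_ge0 // ltW.
rewrite lerXn2r ?nnegrE //.
  by rewrite !mulr_ge0 ?expR_ge0 ?exprn_ge0 // invr_ge0 ltW.
have [xe|xe] := leP eta x.
  apply: (@le_trans _ _ (geometric (expR 1 / eta) ((1 + expR (-2)) * expR (- expR (-2))) k));
    last by rewrite /rate -addrA addrCA lerDl addr_ge0.
  rewrite /geometric /= mulrAC; apply: ler_pM.
  - by rewrite divr_ge0 ?expR_ge0 // ltW.
  - exact: exprn_ge0.
  - by rewrite ler_wpM2l ?expR_ge0 // lef_pV2 ?posrE.
  rewrite lerXn2r ?nnegrE ?mulr_ge0 ?addr_ge0 ?expR_ge0 ?(ltW y0) //.
  (* The function [(1 + y) exp(-y)] decreases on [y >= d]: [1 + y <= (1 + d)(1 + (y - d)) <= (1 + d)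
     exp(y - d)]. *)
  set d := expR (-2) in ye *; have d0 : 0 < d by exact: expR_gt0.
  have -> : expR (- d) = expR (y - d) * expR (- y) by rewrite -expRD; congr expR; ring.
  rewrite mulrA ler_wpM2r ?expR_ge0 //.
  apply: le_trans (_ : (1 + d) * (1 + (y - d)) <= _); first by nra.
  rewrite ler_wpM2l ?expR_ge1Dx //; lra.
apply: (@le_trans _ _ (geometric (4 * expR 1 / eta) (expR (- (eta / 4))) k));
  last by rewrite /rate lerDr addr_ge0.
rewrite /geometric /=.
have kb : k%:R <= 4 / eta * expR (k%:R * (eta / 4)).
  apply: (@le_trans _ _ (4 / eta * (k%:R * (eta / 4)))).
    by rewrite le_eqVlt; apply/orP; left; apply/eqP; field; rewrite gt_eqF.
  rewrite ler_wpM2l ?divr_ge0 ?(ltW e0) //.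
  by apply: le_trans (expR_ge1Dx _); rewrite lerDr.
(* Near [y = 1], [1 + y = 2(1 - x/2) <= 2 exp(-x/2)], so the base is at most [exp(ln 2 - 1 + x/2)],
   and [x < eta]. *)
have step1 : ((1 + y) * expR (- y)) ^+ k <= expR (- (1 - ln 2 - eta / 2) * k%:R).
  rewrite expRM_natr lerXn2r ?nnegrE ?expR_ge0 //.
  have -> : - (1 - ln 2 - eta / 2) = ln 2 + (eta / 2 - 1) by ring.
  rewrite expRD lnK ?posrE //.
  have -> : 1 + y = 2 * (1 - x / 2) by rewrite xE; field.
  rewrite -mulrA ler_pM2l //.
  apply: (@le_trans _ _ (expR (- x / 2) * expR (- y))).
    by rewrite ler_wpM2r ?expR_ge0 // -[X in _ - X]opprK -mulNr opprK expR_ge1Dx.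
  by rewrite -expRD ler_expR; lra.
have step2 : x^-1 <= k%:R * expR ((1 - ln 2 - eta) * k%:R).
  by rewrite /x invf_div ler_pdivrMr // mulrC mulrA.
(* With [c = 1 - ln 2], the exponents add up to [-(c - eta/2) + eta/4 + (c - eta) = -eta/4] times
   [k]. *)
apply: (@le_trans _ _ (expR 1 * expR (- (1 - ln 2 - eta / 2) * k%:R) *
    (4 / eta * expR (k%:R * (eta / 4)) * expR ((1 - ln 2 - eta) * k%:R)))).
  apply: ler_pM; rewrite ?mulr_ge0 ?expR_ge0 ?exprn_ge0 ?invr_ge0 ?(ltW x0) //.
    by rewrite ler_wpM2l ?expR_ge0.
  by apply: le_trans step2 _; rewrite ler_wpM2r ?expR_ge0.
rewrite -expRM_natr [leRHS](_ : _ = expR 1 * (4 / eta) * expR (- (eta / 4) * k%:R)); last by ring.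
rewrite [leLHS](_ : _ = expR 1 * (4 / eta) * (expR (- (1 - ln 2 - eta / 2) * k%:R) *
  expR (k%:R * (eta / 4)) * expR ((1 - ln 2 - eta) * k%:R))); last by ring.
rewrite ler_wpM2l ?mulr_ge0 ?expR_ge0 ?invr_ge0 ?(ltW e0) //.
by rewrite -!expRD ler_expR le_eqVlt; apply/orP; left; apply/eqP; field.
Qed.

(** * Summation over all set sizes *)

Lemma sum_expr_le (R : realFieldType) (q : R) (N : nat) :
  0 <= q <= 1 / 2 -> \sum_(i < N.+1 | (0 < i)%N) q ^+ i <= 2 * q.
Proof.
move=> /andP[q0 q1]; rewrite big_mkcond big_ord_recl /= add0r.
(* The extra tail term makes the induction close: [q^(N+1) + 2q^(N+2) <= 2q^(N+1)] when
   [q <= 1/2]. *)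
suff: \sum_(i < N) q ^+ i.+1 + 2 * q * q ^+ N <= 2 * q.
  by apply: le_trans; rewrite lerDl mulr_ge0 ?exprn_ge0 // mulr_ge0.
elim: N => [|N IHN]; first by rewrite big_ord0 expr0; lra.
apply: le_trans IHN; rewrite big_ord_recr /= -addrA lerD2l exprS.
have q2 : 0 <= 1 - 2 * q by lra.
by have := mulr_ge0 (mulr_ge0 q0 (exprn_ge0 N q0)) q2; lra.
Qed.

Lemma prob_orientable_ge_rate (R : realType) (n m k : nat) (eta : R) :
  (1 < n)%N -> (m <= 'C(n, 2))%N -> (m <= k * (n - 1))%N -> (0 < k)%N -> 0 < eta ->
  (forall s, (0 < s < n)%N -> (k * s < m)%N ->
     n%:R <= (n - s)%:R * k%:R * expR ((1 - ln 2 - eta) * k%:R)) ->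
  rate eta k <= 1 / 2 ->
  1 - 4 * rate eta k <= prob_orientable R n m k.
Proof.
move=> n1 mC mk k0 e0 hs Qle.
have mkn : (m <= k * n)%N by apply: leq_trans mk _; rewrite leq_mul2l leq_subr orbT.
apply: le_trans (prob_orientable_ge R n1 mC mkn).
have Q01 : 0 <= rate eta k <= 1 / 2 by rewrite rate_ge0.
have Q0 : 0 <= rate eta k by rewrite rate_ge0.
have Qx i : 0 <= rate eta k ^+ i by rewrite exprn_ge0.
rewrite lerD2l lerN2.
have ltn s : (k * s < m)%N -> (s < n)%N.
  by move=> /leq_trans /(_ mkn); rewrite ltn_mul2l => /andP[].
apply: (@le_trans _ _ (\sum_(s < n.+1 | (0 < s)%N) rate eta k ^+ s +
                       \sum_(s < n.+1 | (s < n)%N) rate eta k ^+ (n - s))).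
  rewrite [X in X + _]big_mkcond [X in _ + X]big_mkcond -big_split big_mkcond.
  apply: ler_sum => s _ /=; case: ifP => [/andP[s0 sm]|_].
    have sn := ltn _ sm; rewrite s0 sn.
    by apply: union_term_rate => //; apply: hs sm; rewrite s0.
  by apply: addr_ge0; case: ifP.
have := sum_expr_le n Q01.
(* Reversing [s] to [n - s] turns the second sum into the first; each is at most
   [2 * rate eta k]. *)
rewrite [X in _ + X](reindex_inj rev_ord_inj) /=.
rewrite [X in _ + X](eq_big (fun s : 'I_n.+1 => (0 < s)%N) (fun s => rate eta k ^+ s)).
- lra.
- by move=> s; rewrite subSS ltn_subrL; have := ltn_ord s; lia.
- by move=> s _; rewrite subSS subKn // -ltnS.
Qed.

(** * Passage to the limit and the choice of constants *)

Local Open Scope classical_set_scope.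
Local Open Scope ring_scope.

Theorem theorem2p7 (R : realType) (f : nat -> R) (k : nat -> nat) (eps : R) :
  f @ \oo --> +oo ->
  0 < eps ->
  (\forall n \near \oo, f n <= (k n)%:R) ->
  let beta : R := 2 / ln (expR 1 / 2) in
  let phi : nat -> R := fun n =>
    if (1 + eps) / 2 * beta * ln (n%:R) <= (k n)%:R then 0
    else n%:R / expR (2 * (1 - eps) / beta * (k n)%:R) in
  (forall m : nat -> nat,
     (\forall n \near \oo, (m n <= 'C(n, 2))%N) ->
     (\forall n \near \oo, (m n)%:R <= ((k n * (n - 1))%N)%:R - phi n) ->
     (fun n => prob_orientable R n (m n) (k n)) @ \oo --> (1 : R)) /\
  (forall m : nat -> nat,
     (\forall n \near \oo, (k n * n + 1 <= m n)%N) ->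
     (fun n => prob_orientable R n (m n) (k n)) @ \oo --> (0 : R)).
Proof.
move=> foo eps0 fk beta phi; split=> m; last first.
  (* With more than [kn] edges no orientation exists, so the probability is eventually exactly 0. *)
  move=> km; apply: cvg_near_cst; near=> n.
  rewrite /prob_orientable (_ : [set _ in _ | _] = finset.set0) ?cards0 ?mul0r //.
  apply/setP => E; rewrite !inE; apply/negbTE/negP => /andP[/andP[_ /eqP Em]].
  move/k_orientable_card; rewrite Em leqNgt -addn1.
  by have -> : (k n * n + 1 <= m n)%N by near: n.
move=> mC mphi.
have koo : k @ \oo --> \oo.
  by apply/cvgrnyP; apply: ger_cvgy foo.
(* This is [ln(e/2) = 2/beta]. *)
set c := 1 - ln 2 : R.
have c0 : 0 < c.
  rewrite subr_gt0 -[ltRHS]expRK ltr_ln ?posrE ?expR_gt0 //.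
  by have := expR_gt1Dx (oner_neq0 R); lra.
have betaE : beta = 2 / c.
  by rewrite /beta ln_div ?posrE ?expR_gt0 // expRK.
(* Chosen to serve both ranges of [k]: [c - eta = c/(1 + eps)] for large [k], and [eta <= c * eps]
   for small [k]. *)
pose eta := c * eps / (1 + eps).
have eta0 : 0 < eta by rewrite divr_gt0 ?mulr_gt0 // addr_gt0.
have eta_eps : eta <= c * eps.
  rewrite /eta ler_pdivrMr ?addr_gt0 // ler_peMr ?lerDl ?mulr_ge0 // ltW //.
have c_eta : c - eta = c / (1 + eps).
  by rewrite /eta; field; rewrite gt_eqF // addr_gt0.
have Q_0 : rate eta (k n) @[n --> \oo] --> (0 : R).
  exact: (cvg_comp _ _ koo (rate_cvg0 eta0)).
apply: (@squeeze_cvgr _ _ _ _ (fun n => 1 - 4 * rate eta (k n)) (fun=> 1)).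
- near=> n; apply/andP; split; last first.
    rewrite /prob_orientable ler_pdivrMr.
      by rewrite mul1r ler_nat subset_leq_card //; apply/subsetP => E; rewrite inE => /andP[].
    rewrite ltr0n card_graphs_nm bin_gt0; by near: n.
  have n1 : (1 < n)%N by near: n; exact: nbhs_infty_gt.
  have k0 : (0 < k n)%N by near: n; exact: (koo _ (nbhs_infty_gt 0)).
  have n0 : 0 < n%:R :> R by rewrite ltr0n ltnW.
  have kR : 1 <= (k n)%:R :> R by rewrite ler1n.
  have phi0 : 0 <= phi n.
    by rewrite /phi; case: ifP => // _; rewrite divr_ge0 ?expR_ge0.
  have mphin : (m n)%:R <= (k n * (n - 1))%:R - phi n by near: n.
  apply: prob_orientable_ge_rate => //.
  + by near: n.
  + by rewrite -(ler_nat R); apply: le_trans mphin _; rewrite gerBl.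
  + move=> s /andP[s0 sn] ksm.
    have t1 : 1 <= (n - s)%:R :> R by rewrite ler1n subn_gt0.
    have tk1 : 1 <= (n - s)%:R * (k n)%:R :> R by rewrite mulr_ege1.
    (* From [ks < m <= k(n-1) - phi]. *)
    have phit : phi n <= (n - s)%:R * (k n)%:R.
      have : (k n * s)%:R <= (m n)%:R :> R by rewrite ler_nat ltnW.
      move: mphin; rewrite !natrM !natrB ?(ltnW n1) ?(ltnW sn) //.
      have : 0 <= (k n)%:R :> R by [].
      nra.
    have := phit; rewrite /phi betaE.
    case: ifP => [kbig _|_ phi_le].
      (* Here [k >= (1 + eps)/c * ln n], so the exponential alone is at least [n]. *)
      rewrite -[leLHS]mul1r; apply: ler_pM => //.
      rewrite -[leLHS]lnK ?posrE // ler_expR -/c c_eta.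
      rewrite [leRHS]mulrAC ler_pdivlMr ?addr_gt0 //.
      move: kbig; rewrite -(ler_pM2l c0); congr (_ <= _).
      by field; rewrite gt_eqF.
    (* Here [phit] reads [n <= (n - s) k exp(c(1 - eps)k)], and [c(1 - eps) <= c - eta]. *)
    move: phi_le; rewrite ler_pdivrMr ?expR_gt0 // => /le_trans; apply.
    rewrite ler_wpM2l ?mulr_ge0 // ler_expR ler_wpM2r // -/c.
    have -> : 2 * (1 - eps) / (2 / c) = c - c * eps by field; rewrite gt_eqF.
    lra.
  + near: n; apply: (cvgr_le 0 Q_0); lra.
- rewrite -[X in _ --> X]subr0 -[X in _ - X](mulr0 4).
  by apply: cvgB; [exact: cvg_cst|apply: cvgM Q_0; exact: cvg_cst].
- exact: cvg_cst.
Unshelve. all: by end_near.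
Qed.
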